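(* Let $\mathcal X$ be a zero-nonzero pattern. Then $L(\mathcal X)^*\simeq L(\mathcal X^T)$, with a lattice isomorphism $\phi:L(\mathcal X)^*\to L(\mathcal X^T)$ given by $\phi(A)=Z(A)$.
   Context: A zero-nonzero pattern is a matrix with entries in $\{0,*\}$. For a row label $x$, $Z(x)$ is the set of column labels where row $x$ has entry $0$; for a column label $x$, $Z(x)$ is the set of row labels where column $x$ has entry $0$; for a set $A$ of column labels, $Z(A)=\bigcap_{a\in A}Z(a)$ (a set of row labels of $\mathcal X$, i.e., of column labels of $\mathcal X^T$). The intersection lattice $L(\mathcal X)$ is the set of all intersections of zero sets of rows of $\mathcal X$ (the empty intersection being the full set of column labels), ordered by inclusion. For a lattice $L$, the dual lattice $L^*$ is the same set with all order relations reversed. *)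

(* Defs.v *)
From HB Require Import structures.
From mathcomp Require Import all_boot all_order all_algebra.

Set Implicit Arguments.
Unset Strict Implicit.
Unset Printing Implicit Defensive.

Variant zn_entry : Type := Zero | Star.

Definition is_zero (e : zn_entry) : bool := if e is Zero then true else false.

Notation zn_pattern m n := 'M[zn_entry]_(m, n).

Definition Zrow (m n : nat) (X : zn_pattern m n) (i : 'I_m) : {set 'I_n} :=
  [set j | is_zero (X i j)].

Definition Zcol (m n : nat) (X : zn_pattern m n) (j : 'I_n) : {set 'I_m} :=
  [set i | is_zero (X i j)].

Definition Zset (m n : nat) (X : zn_pattern m n) (A : {set 'I_n}) : {set 'I_m} :=
  \bigcap_(a in A) Zcol X a.

Definition zero_intersections (m n : nat) (X : zn_pattern m n) :
    {set {set 'I_n}} :=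
  [set \bigcap_(i in R) Zrow X i | R : {set 'I_m}].

Lemma zero_intersectionsT (m n : nat) (X : zn_pattern m n) :
  [set: 'I_n] \in zero_intersections X.
Proof. by apply/imsetP; exists set0; rewrite ?inE ?big_set0. Qed.

Lemma zero_intersectionsI (m n : nat) (X : zn_pattern m n) (A B : {set 'I_n}) :
  A \in zero_intersections X -> B \in zero_intersections X ->
  A :&: B \in zero_intersections X.
Proof.
move=> /imsetP[R _ ->] /imsetP[S _ ->].
by apply/imsetP; exists (R :|: S); rewrite ?inE ?bigcap_setU.
Qed.

Record intlat (m n : nat) (X : zn_pattern m n) : Type := IntLat {
  intlat_val :> {set 'I_n};
  intlat_valP : intlat_val \in zero_intersections X
}.

HB.instance Definition _ (m n : nat) (X : zn_pattern m n) :=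
  [isSub for @intlat_val m n X].
HB.instance Definition _ (m n : nat) (X : zn_pattern m n) :=
  [Finite of intlat X by <:].

Fact intlat_display : Order.disp_t. Proof. exact: Order.Disp tt tt. Qed.

Definition intlat_le (m n : nat) (X : zn_pattern m n) : rel (intlat X) :=
  fun A B => intlat_val A \subset intlat_val B.

Lemma intlat_le_refl (m n : nat) (X : zn_pattern m n) :
  reflexive (@intlat_le m n X).
Proof. by move=> A; apply: subxx. Qed.

Lemma intlat_le_anti (m n : nat) (X : zn_pattern m n) :
  antisymmetric (@intlat_le m n X).
Proof. by move=> A B AB; apply/val_inj/eqP; rewrite eqEsubset. Qed.

Lemma intlat_le_trans (m n : nat) (X : zn_pattern m n) :
  transitive (@intlat_le m n X).
Proof. by move=> B A C; apply: subset_trans. Qed.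

HB.instance Definition _ (m n : nat) (X : zn_pattern m n) :=
  Order.Le_isPOrder.Build intlat_display (intlat X)
    (@intlat_le_refl m n X) (@intlat_le_anti m n X) (@intlat_le_trans m n X).

Definition intlat_meet (m n : nat) (X : zn_pattern m n) (A B : intlat X) :
    intlat X :=
  IntLat (zero_intersectionsI (intlat_valP A) (intlat_valP B)).

(* The union of two members of L(X) need not be in L(X): their join is the
   least member containing it. *)
Definition intlat_hull (m n : nat) (X : zn_pattern m n) (S : {set 'I_n}) :
    {set 'I_n} :=
  \bigcap_(C in zero_intersections X | S \subset C) C.

Lemma intlat_hullP (m n : nat) (X : zn_pattern m n) (S : {set 'I_n}) :
  intlat_hull X S \in zero_intersections X.
Proof.
apply: (big_ind (fun A => A \in zero_intersections X)).
- exact: zero_intersectionsT.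
- exact: zero_intersectionsI.
- by move=> C /andP[].
Qed.

Definition intlat_join (m n : nat) (X : zn_pattern m n) (A B : intlat X) :
    intlat X :=
  IntLat (intlat_hullP X (A :|: B)).

Lemma intlat_meetP (m n : nat) (X : zn_pattern m n) (A B C : intlat X) :
  intlat_le A (intlat_meet B C) = intlat_le A B && intlat_le A C.
Proof. by rewrite /intlat_le /= subsetI. Qed.

Lemma intlat_joinP (m n : nat) (X : zn_pattern m n) (A B C : intlat X) :
  intlat_le (intlat_join A B) C = intlat_le A C && intlat_le B C.
Proof.
rewrite /intlat_le /= -subUset; apply/idP/idP => sABC; last first.
  by apply: bigcap_inf; rewrite intlat_valP.
by apply: subset_trans sABC; apply/bigcapsP => D /andP[].
Qed.

HB.instance Definition _ (m n : nat) (X : zn_pattern m n) :=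
  Order.POrder_MeetJoin_isLattice.Build intlat_display (intlat X)
    (@intlat_meetP m n X) (@intlat_joinP m n X).

(* Main.v *)
(* Z is a Galois connection between sets of column labels and sets of row
   labels, and the elements of L(X) and of L(X^T) are exactly its closed sets.
   Z therefore restricts to mutually inverse, order-reversing bijections, and an
   order isomorphism between lattices preserves meets and joins. *)
From HB Require Import structures.
Require Import Defs.
From mathcomp Require Import all_boot all_order all_algebra.

Set Implicit Arguments.
Unset Strict Implicit.
Unset Printing Implicit Defensive.

Import Order.LTheory.

(** Monotonicity gives one inequality; for the other, [f x] meet [f y] is pulled back along the
    inverse [g] and compared with [x] and [y] in [L]. *)
Lemma mono_bij_meet_morphism d (L : latticeType d) d' (L' : latticeType d')
    (f : L -> L') :
  bijective f -> {mono f : x y / (x <= y)%O} -> Order.meet_morphism f.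
Proof.
move=> [g fK gK] f_mono x y; apply/le_anti.
rewrite lexI !f_mono leIl leIr /= -[X in (X <= _)%O]gK f_mono lexI.
by rewrite -(f_mono _ x) -(f_mono _ y) gK leIl leIr.
Qed.

Lemma mono_bij_join_morphism d (L : latticeType d) d' (L' : latticeType d')
    (f : L -> L') :
  bijective f -> {mono f : x y / (x <= y)%O} -> Order.join_morphism f.
Proof.
move=> f_bij f_mono.
(* Joins are meets in the dual lattices, between which [f] is still monotone. *)
apply: (@mono_bij_meet_morphism _ L^d _ L'^d) => // x y; exact: f_mono.
Qed.

Lemma zero_intersections_tr m n (X : zn_pattern m n) :
  zero_intersections (X^T)%R = [set Zset X A | A : {set 'I_n}].
Proof.
apply: eq_imset => A; apply: eq_bigr => i _.
by apply/setP => j; rewrite !inE mxE.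
Qed.

(** Both sides say that [X] vanishes on the block with rows [R] and columns [A]. *)
Lemma Zset_galois m n (X : zn_pattern m n) (A : {set 'I_n}) (R : {set 'I_m}) :
  (R \subset Zset X A) = (A \subset Zset (X^T)%R R).
Proof.
apply/bigcapsP/bigcapsP => sub k kin; apply/subsetP => l lin.
  by move: (subsetP (sub _ lin) _ kin); rewrite !inE mxE.
by move: (subsetP (sub _ lin) _ kin); rewrite !inE mxE.
Qed.

Lemma Zset_sub m n (X : zn_pattern m n) (A B : {set 'I_n}) :
  A \subset B -> Zset X B \subset Zset X A.
Proof.
by move=> sAB; rewrite Zset_galois (subset_trans sAB) // -Zset_galois.
Qed.

Lemma sub_ZsetK m n (X : zn_pattern m n) (A : {set 'I_n}) :
  A \subset Zset (X^T)%R (Zset X A).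
Proof. by rewrite -Zset_galois. Qed.

Lemma ZsetK m n (X : zn_pattern m n) (A : {set 'I_n}) :
  A \in zero_intersections X -> Zset (X^T)%R (Zset X A) = A.
Proof.
(* Reading [X] as the transpose of its transpose puts [A] in the form [Zset X^T R]. *)
rewrite -{1}(trmxK X) zero_intersections_tr => /imsetP[R _ ->].
apply/eqP; rewrite eqEsubset sub_ZsetK andbT.
(* As Z reverses inclusions, it suffices that [R] lies in its own double Z. *)
by rewrite Zset_sub // Zset_galois.
Qed.

Lemma Zset_zero_intersections m n (X : zn_pattern m n) (A : {set 'I_n}) :
  Zset X A \in zero_intersections (X^T)%R.
Proof. by rewrite zero_intersections_tr imset_f. Qed.

Definition intlat_Z m n (X : zn_pattern m n) (A : intlat X) : intlat (X^T)%R :=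
  IntLat (Zset_zero_intersections X A).

(** The inverse is the Z of the transpose: [ZsetK] for [X] and for [X^T] gives the two
    cancellations. *)
Lemma intlat_Z_bij m n (X : zn_pattern m n) : bijective (@intlat_Z m n X).
Proof.
have ZP (R : {set 'I_m}) : Zset (X^T)%R R \in zero_intersections X.
  by rewrite -{2}(trmxK X) Zset_zero_intersections.
have ZK := @ZsetK _ _ (X^T)%R; rewrite trmxK in ZK.
exists (fun R : intlat (X^T)%R => IntLat (ZP R)) => [A|R]; apply: val_inj => /=.
  exact: ZsetK (intlat_valP A).
exact: ZK (intlat_valP R).
Qed.

Lemma intlat_Z_mono m n (X : zn_pattern m n) :
  {mono (@intlat_Z m n X : (intlat X)^d -> intlat (X^T)%R) :
    A B / (A <= B)%O}.
Proof.
move=> A B; rewrite leEdual.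
change ((Zset X A \subset Zset X B) = (intlat_val B \subset intlat_val A)).
(* Z(A) lies in Z(B) iff B lies in Z(Z(A)), which is A because A is closed. *)
by rewrite Zset_galois ZsetK ?intlat_valP.
Qed.

Theorem theorem4p5 (m n : nat) (X : zn_pattern m n) :
  exists phi : {lmorphism (intlat X)^d -> intlat (X^T)%R},
    bijective phi /\
    forall A : intlat X,
      intlat_val (phi A) = Zset X (intlat_val A).
Proof.
pose f : (intlat X)^d -> intlat (X^T)%R := @intlat_Z m n X.
have f_bij : bijective f := intlat_Z_bij X.
have f_mono : {mono f : A B / (A <= B)%O} := @intlat_Z_mono m n X.
have f_homo : {homo f : A B / (A <= B)%O} by move=> A B; rewrite f_mono.
(* Meets in the dual are hulls of unions, but need no computation: [f_bij] and [f_mono] force both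
   operations to be preserved. *)
pose Hle := Order.isOrderMorphism.Build _ _ _ _ f f_homo.
pose Hmeet := Order.isMeetLatticeMorphism.Build _ _ _ _ f
  (mono_bij_meet_morphism f_bij f_mono).
pose Hjoin := Order.isJoinLatticeMorphism.Build _ _ _ _ f
  (mono_bij_join_morphism f_bij f_mono).
pose phi : {lmorphism (intlat X)^d -> intlat (X^T)%R} :=
  HB.pack f Hle Hmeet Hjoin.
by exists phi.
Qed.
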